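(* Consider a deterministic positive semilinear problem with data $(X,U,U(\cdot),f,g,\alpha,\widehat{\mathcal M})$ satisfying Closure and Attainability, Stabilizability, State Space Structure, and Observability (all as defined in the context), and let $c^*$ be its optimal cost vector. Then for any initial vector $c_0\in\mathbb R^n_+$, the sequence $\{c_k\}$ generated by the value iteration algorithm $c_{k+1}=G(c_k)$, $k=0,1,\dots$, converges to $c^*$.
   Context: Notation: $\mathbb R^n_+$ is the set of vectors in $\mathbb R^n$ with nonnegative components; a prime denotes transposition. Deterministic positive semilinear problem: the state space $X$ is a subset of $\mathbb R^n_+$, $U$ is a control space, and for each $x\in X$, $U(x)\subset U$ is a nonempty control constraint set. The functions $f:X\times U\to\mathbb R^n$ and $g:X\times U\to\mathbb R$ satisfy $f(x,u)\in X$ and $g(x,u)\ge 0$ for all $x\in X$, $u\in U(x)$; $\alpha\in(0,1]$ is a scalar. For $x_0\in X$, the problem is to minimize $\sum_{k=0}^\infty\alpha^k g(x_k,u_k)$ over control sequences $\{u_k\}$ subject to $x_{k+1}=f(x_k,u_k)$, $u_k\in U(x_k)$, $k=0,1,\dots$. $J^*(x_0)$ denotes the optimal cost (infimum) starting from $x_0$. A (stationary) policy is a function $\mu:X\to U$ with $\mu(x)\in U(x)$ for all $x\in X$. $\widehat{\mathcal M}$ is a given set of policies such that for every $\mu\in\widehat{\mathcal M}$ there exist an $n\times n$ nonnegative matrix $A_\mu$ and a vector $q_\mu\in\mathbb R^n$ with $f(x,\mu(x))=A_\mu x$ and $g(x,\mu(x))=q_\mu'x$ for all $x\in X$. $\widehat{\mathcal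 J}$ is the set of functions $J(x)=c'x$ on $X$ with $c\in\mathbb R^n_+$. Assumptions: Closure and Attainability: for every $c\in\mathbb R^n_+$, the function $x\mapsto\min_{u\in U(x)}[g(x,u)+\alpha c'f(x,u)]$ belongs to $\widehat{\mathcal J}$, i.e., equals $\hat c'x$ for some unique $\hat c\in\mathbb R^n_+$; $\hat c$ depends continuously on $c$; and there is a policy $\mu\in\widehat{\mathcal M}$ with $\mu(x)\in\arg\min_{u\in U(x)}[g(x,u)+\alpha c'f(x,u)]$ for all $x\in X$. Stabilizability: there exists $\hat\mu\in\widehat{\mathcal M}$ such that $\alpha A_{\hat\mu}$ is stable (all its eigenvalues lie strictly within the unit circle). State Space Structure: for every $v\in\mathbb R^n_+$ there exist $x\in X$ and a scalar $s\ge0$ with $sx=v$. Observability: there exists an integer $N$ such that for every nonzero $x_0\in X$ the optimal cost of the $N$-stage problem of minimizing $\sum_{k=0}^{N-1}\alpha^k g(x_k,u_k)$ starting from $x_0$ is strictly positive. The mapping $G:\mathbb R^n_+\to\mathbb R^n_+$ is defined by letting $G(c)$ be the unique vector with $G(c)'x=\min_{u\in U(x)}[g(x,u)+\alpha c'f(x,u)]$ for all $x\in X$. The optimal cost vector $c^*$ is the vector in $\mathbb R^n_+$ such that $J^*(x)=(c^* )'x$ for all $x\in X$; under the assumptions above it exists, has strictly positive components, and is the unique solution of $c=G(c)$ in $\mathbb R^n_+$. *)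

(* Defs.v *)
From HB Require Import structures.
From mathcomp Require Import all_boot all_order all_algebra.
From mathcomp Require Import all_classical all_reals all_analysis.
From mathcomp Require Import complex.
Set Implicit Arguments.
Unset Strict Implicit.
Unset Printing Implicit Defensive.
Import Order.TTheory GRing.Theory Num.Theory.
Import numFieldNormedType.Exports.
Local Open Scope classical_set_scope.
Local Open Scope ring_scope.

Definition dotv (R : realType) (n : nat) (c x : 'cV[R]_n) : R :=
  (c^T *m x) 0 0.

Definition nneg_orthant (R : realType) (n : nat) : set 'cV[R]_n :=
  [set c | c \is a mxOver Num.nneg].

(* The eigenvalues of a real matrix are its complex ones. *)
Definition stable_mx (R : realType) (n : nat) (A : 'M[R]_n) : Prop :=
  forall z : R[i], eigenvalue (map_mx (real_complex R) A) z -> `|z| < 1.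

Definition is_minimum (R : realType) (S : set R) (m : R) : Prop :=
  S m /\ lbound S m.

(* f, g, the constraint sets and the policies are total functions of the state,
   but only their values on the state space [states] are ever constrained or
   used.  The domain conditions are in [is_semilinear]. *)
Record problem (R : realType) (n : nat) (U : Type) := Problem {
  states : set 'cV[R]_n;
  controls : 'cV[R]_n -> set U;
  dyn : 'cV[R]_n -> U -> 'cV[R]_n;
  cost : 'cV[R]_n -> U -> R;
  discount : R;
  policies : set ('cV[R]_n -> U) }.

Section Semilinear.
Context {R : realType} {n : nat} {U : Type}.
Variable P : problem R n U.
Implicit Types (c x : 'cV[R]_n) (u : nat -> U) (mu : 'cV[R]_n -> U).

Local Notation X := (states P).
Local Notation Uc := (controls P).
Local Notation f := (dyn P).
Local Notation g := (cost P).
Local Notation alpha := (discount P).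
Local Notation Mhat := (policies P).

Definition is_policy mu : Prop := forall x, X x -> Uc x (mu x).

Definition linear_dyn mu (A : 'M[R]_n) : Prop :=
  A \is a mxOver Num.nneg /\ forall x, X x -> f x (mu x) = A *m x.

Definition linear_cost mu (q : 'cV[R]_n) : Prop :=
  forall x, X x -> g x (mu x) = dotv q x.

Record is_semilinear : Prop := IsSemilinear {
  states_nneg : X `<=` @nneg_orthant R n;
  controls_nonempty : forall x, X x -> Uc x !=set0;
  dyn_states : forall x v, X x -> Uc x v -> X (f x v);
  cost_ge0 : forall x v, X x -> Uc x v -> 0 <= g x v;
  discount_gt0 : 0 < alpha;
  discount_le1 : alpha <= 1;
  policies_admissible : forall mu, Mhat mu -> is_policy mu;
  policies_linear : forall mu, Mhat mu ->
    exists (A : 'M[R]_n) (q : 'cV[R]_n), linear_dyn mu A /\ linear_cost mu q }.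

Fixpoint trajectory x u (k : nat) : 'cV[R]_n :=
  if k is j.+1 then f (trajectory x u j) (u j) else x.

Definition stage_cost x u (k : nat) : R :=
  alpha ^+ k * g (trajectory x u k) (u k).

Definition admissible x u : Prop := forall k, Uc (trajectory x u k) (u k).

Definition admissible_upto (N : nat) x u : Prop :=
  forall k, (k < N)%N -> Uc (trajectory x u k) (u k).

Definition optimal_cost x : \bar R :=
  ereal_inf [set (\sum_(0 <= k <oo) (stage_cost x u k)%:E)%E
            | u in [set u | admissible x u]].

Definition optimal_cost_upto (N : nat) x : \bar R :=
  ereal_inf [set (\sum_(0 <= k < N) stage_cost x u k)%:E
            | u in [set u | admissible_upto N x u]].

Definition bellman_rhs c x (v : U) : R := g x v + alpha * dotv c (f x v).

Definition bellman_vector c c' : Prop :=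
  nneg_orthant c' /\
  forall x, X x -> is_minimum [set bellman_rhs c x v | v in Uc x] (dotv c' x).

(* Only meaningful when [bellman_vector c] holds of exactly one vector; 0 is
   a default value. *)
Definition G c : 'cV[R]_n := xget 0 [set c' | bellman_vector c c'].

Definition argmin_bellman c x : set U :=
  [set v | Uc x v /\ forall w, Uc x w -> bellman_rhs c x v <= bellman_rhs c x w].

Definition closure_attainability : Prop :=
  [/\ forall c, nneg_orthant c -> exists! c', bellman_vector c c',
      {within @nneg_orthant R n, continuous G} &
      forall c, nneg_orthant c -> exists mu, Mhat mu /\
        forall x, X x -> argmin_bellman c x (mu x)].

Definition stabilizability : Prop :=
  exists mu (A : 'M[R]_n),
    [/\ Mhat mu, linear_dyn mu A & stable_mx (alpha *: A)].

Definition state_space_structure : Prop :=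
  forall v, nneg_orthant v -> exists x (s : R), [/\ X x, 0 <= s & s *: x = v].

Definition observability : Prop :=
  exists N : nat, forall x, X x -> x != 0 -> (0 < optimal_cost_upto N x)%E.

Definition is_optimal_cost_vector c : Prop :=
  nneg_orthant c /\ forall x, X x -> optimal_cost x = (dotv c x)%:E.

(* As for [G], 0 is a default value. *)
Definition optimal_cost_vector : 'cV[R]_n :=
  xget 0 [set c | is_optimal_cost_vector c].

End Semilinear.

(* Main.v *)
(* [G] is monotone, and is dominated by the affine map c |-> q + B c, with
   B = alpha A', of any policy. The stabilizing policy keeps the increasing
   sequence G^k(0) bounded, so it converges to a fixed point c of [G]. Policies
   attaining the minimum in G(c) cost at most c'x, while every control sequence
   costs at least G^k(0)'x, so c = c*. For such a policy, observability
   forces B^k -> 0 on the orthant, and G^k(c0) is squeezed between G^k(0) and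
   c + B^k (c0 - c). *)
Require Import Defs.
From HB Require Import structures.
From mathcomp Require Import all_boot all_order all_algebra.
From mathcomp Require Import all_classical all_reals all_analysis.
From mathcomp Require Import complex.
From mathcomp Require Import lra.
Set Implicit Arguments.
Unset Strict Implicit.
Unset Printing Implicit Defensive.
Import Order.TTheory GRing.Theory Num.Theory.
Import numFieldNormedType.Exports.
Local Open Scope classical_set_scope.
Local Open Scope ring_scope.

(** * Powers of a stable matrix *)

Lemma cvg0_contraction (R : realType) (r : R) (x e : nat -> R) :
  0 <= r < 1 -> (forall k, 0 <= x k) ->
  (forall k, x k.+1 <= r * x k + e k) ->
  e @ \oo --> 0 -> x @ \oo --> 0.
Proof.
move=> /andP[r0 r1] x0 xS e0; apply/cvgrPdist_le => eps eps0.
(* This threshold makes [eps / 2] the fixed point of [t |-> r * t + (1 - r) * (eps / 2)]. Once [e]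
   stays below it, the excess of [x] over [eps / 2] is controlled by powers of [r]. *)
have d0 : 0 < (1 - r) * (eps / 2) by rewrite mulr_gt0 ?divr_gt0 ?subr_gt0.
have /cvgrPdist_le/(_ _ d0) [K _ eK] := e0.
have xK j : x (j + K)%N <= eps / 2 + r ^+ j * x K.
  elim: j => [|j IH]; first by rewrite expr0 mul1r lerDr; lra.
  have := xS (j + K)%N; have := eK (j + K)%N (leq_addl _ _).
  rewrite sub0r normrN ler_norml => /andP[_ h1] h2.
  have := ler_wpM2l r0 IH; rewrite addSn exprS; lra.
have : (fun j => r ^+ j * x K) @ \oo --> 0.
  rewrite -[X in _ --> X](mul0r (x K)); apply: cvgMl.
  by apply: cvg_expr; rewrite ger0_norm.
move=> /cvgrPdist_le/(_ (eps / 2)) []; first by rewrite divr_gt0.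
move=> M _ hM; exists (M + K)%N => // k /= kMK.
have kK : (K <= k)%N by rewrite (leq_trans _ kMK) ?leq_addl.
have /hM : (M <= k - K)%N by rewrite leq_subRL // addnC.
have := xK (k - K)%N; rewrite subnK // !sub0r !normrN (ger0_norm (x0 _)).
by rewrite ger0_norm ?mulr_ge0 ?exprn_ge0 //; lra.
Qed.

(** [Normc.normc] takes values in [R], whereas [|z|] lies in [R[i]], so these are limits of real
    sequences. *)
Definition null_mxseq (R : realType) m n (M : nat -> 'M[R[i]]_(m, n)) :=
  forall i j, (fun k => Normc.normc (M k i j)) @ \oo --> 0.

Lemma normc_ge0 (R : realType) (z : R[i]) : 0 <= Normc.normc z.
Proof. by rewrite -lecR; exact: (@normr_ge0 _ _ z). Qed.

(** Entrywise, [M k.+1] is [z *: M k] plus a vanishing error, so the triangle inequality gives a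
    contraction of ratio [|z|]. *)
Lemma null_mxseq_contraction (R : realType) m n (z : R[i])
    (M : nat -> 'M[R[i]]_(m, n)) :
  `|z| < 1 -> null_mxseq (fun k => M k.+1 - z *: M k) -> null_mxseq M.
Proof.
move=> z1 MS i j; apply: (cvg0_contraction (r := Normc.normc z) _ _ _ (MS i j)).
- by rewrite normc_ge0 -ltcR.
- by move=> k; exact: normc_ge0.
move=> k; rewrite -Normc.normcM addrC.
have -> : M k.+1 i j = (M k.+1 - z *: M k) i j + z * M k i j.
  by rewrite !mxE subrK.
exact: le_normcD.
Qed.

(* By Cayley-Hamilton the product of the [B - z], [z] ranging over the
   eigenvalues, is zero; [null_mxseq_contraction] strips off these factors one
   at a time. *)
Lemma stable_mx_exp (R : realType) n (A : 'M[R]_n) :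
  stable_mx A -> forall i j, (fun k => (A ^+ k) i j) @ \oo --> 0.
Proof.
case: n A => [A _ [] //|n A stA i j].
pose B := map_mx (real_complex R) A.
have [s sE] := closed_field_poly_normal (char_poly B).
rewrite (monicP (char_poly_monic B)) scale1r in sE.
have s1 z : z \in s -> `|z| < 1.
  by move=> zs; apply: stA; rewrite eigenvalue_root_char -/B sE root_prod_XsubC.
have hs (t : seq R[i]) : (forall z, z \in t -> `|z| < 1) ->
    null_mxseq (fun k => B ^+ k *m horner_mx B (\prod_(z <- t) ('X - z%:P))) ->
    null_mxseq (fun k => B ^+ k).
  elim: t => [_|z t IH zt].
    by rewrite big_nil rmorph1 => + i' j' => /(_ i' j'); under eq_fun do rewrite mulmx1.
  rewrite big_cons => H; apply: IH => [y yt|]; first by rewrite zt ?inE ?yt ?orbT.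
  (* With [p] the product over [t], the difference [B^(k+1) p(B) - z B^k p(B)] is
     [B^k (B - z) p(B)], which vanishes in the limit by [H]. *)
  apply: (null_mxseq_contraction (zt z (mem_head _ _))) => i' j'.
  have := H i' j'; rewrite rmorphM rmorphB /= horner_mx_X horner_mx_C.
  apply: cvg_trans; apply: near_eq_cvg; apply: nearW => k; congr (Normc.normc (_ i' j')).
  by rewrite [in LHS]mulrBl mulmxBr -!mulmxE mulmxA mul_scalar_mx -scalemxAr exprSr.
have : null_mxseq (fun k => B ^+ k).
  apply: (hs s s1) => i' j'; rewrite -sE Cayley_Hamilton.
  rewrite (_ : (fun _ => _) = cst 0); first exact: cvg_cst.
  by apply/funext => k; rewrite mulmx0 mxE Normc.normc0.
move=> /(_ i j) cvgB; apply/norm_cvg0P; apply: cvg_trans cvgB.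
apply: near_eq_cvg; apply: nearW => k.
rewrite /B -rmorphXn /= mxE /= /Normc.normc /= expr0n addr0.
by rewrite sqrtr_sqr.
Qed.

(** * Entrywise convergence of matrices *)

Lemma cvg_mx_entry (R : realType) m n (u : nat -> 'M[R]_(m, n)) (l : 'M[R]_(m, n)) :
  (forall i j, (fun k => u k i j) @ \oo --> l i j) -> u @ \oo --> l.
Proof.
(* A neighbourhood of [l] contains a product of neighbourhoods of its entries; these are finitely
   many, hence eventually met together. *)
move=> ul S [Q lQ QS]; have Qu : \forall k \near \oo, forall i j, Q i j (u k i j).
  by apply: filter_forall => i; apply: filter_forall => j; exact: ul _ _ _ (lQ i j).
by apply: filterS Qu => k Qk; exact: QS.
Qed.

Lemma cvg_entry_mx (R : realType) m n (u : nat -> 'M[R]_(m, n)) (l : 'M[R]_(m, n)) i j :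
  u @ \oo --> l -> (fun k => u k i j) @ \oo --> l i j.
Proof.
move=> ul S lS; apply: (ul [set M | S (M i j)]).
(* Only the entry [(i, j)] is constrained. *)
exists (fun i' j' => if (i' == i) && (j' == j) then S else setT).
  by move=> i' j'; case: ifP => [/andP[/eqP-> /eqP->] //|_]; exact: filterT.
by move=> M /(_ i j); rewrite !eqxx.
Qed.

(** * Dot products and the componentwise order *)

Section DotProduct.
Context {R : realType} {n : nat}.
Implicit Types (c d x : 'cV[R]_n) (A : 'M[R]_n).

Definition le_cv c d : Prop := forall i, c i 0 <= d i 0.

Lemma nneg_orthantP c : nneg_orthant c <-> le_cv 0 c.
Proof.
split=> [/mxOverP c0 i|c0]; first by have := c0 i 0; rewrite mxE.
by apply/mxOverP => i j; rewrite ord1 nnegrE; have := c0 i; rewrite mxE.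
Qed.

Lemma le_cv_trans d c e : le_cv c d -> le_cv d e -> le_cv c e.
Proof. by move=> cd de i; exact: le_trans (cd i) (de i). Qed.

Lemma le_cv_anti c d : le_cv c d -> le_cv d c -> c = d.
Proof. by move=> cd dc; apply/colP => i; apply/le_anti; rewrite cd dc. Qed.

Lemma dotvE c x : dotv c x = \sum_i c i 0 * x i 0.
Proof. by rewrite /dotv mxE; apply: eq_bigr => i _; rewrite mxE. Qed.

Lemma dotvDl c d x : dotv (c + d) x = dotv c x + dotv d x.
Proof. by rewrite /dotv linearD mulmxDl mxE. Qed.

Lemma dotvBl c d x : dotv (c - d) x = dotv c x - dotv d x.
Proof. by rewrite /dotv linearB mulmxBl !mxE. Qed.

Lemma dotvZl a c x : dotv (a *: c) x = a * dotv c x.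
Proof. by rewrite /dotv linearZ -scalemxAl mxE. Qed.

Lemma dotvZr a c x : dotv c (a *: x) = a * dotv c x.
Proof. by rewrite /dotv -scalemxAr mxE. Qed.

Lemma dotv_mulmx c A x : dotv (A^T *m c) x = dotv c (A *m x).
Proof. by rewrite /dotv trmx_mul trmxK mulmxA. Qed.

Lemma dotv_delta c i : dotv c (delta_mx i 0) = c i 0.
Proof.
rewrite dotvE (bigD1 i) //= mxE !eqxx mulr1 big1 ?addr0 // => j ji.
by rewrite mxE (negbTE ji) mulr0.
Qed.

Lemma dotv0l x : dotv 0 x = 0.
Proof. by rewrite /dotv trmx0 mul0mx mxE. Qed.

Lemma dotv_le c d x : le_cv 0 x -> le_cv c d -> dotv c x <= dotv d x.
Proof.
move=> x0 cd; rewrite !dotvE; apply: ler_sum => i _.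
by apply: ler_wpM2r => //; have := x0 i; rewrite mxE.
Qed.

Lemma mulmx_le A c d : A \is a mxOver Num.nneg -> le_cv c d ->
  le_cv (A *m c) (A *m d).
Proof.
move=> /mxOverP A0 cd i; rewrite !mxE; apply: ler_sum => j _.
by apply: ler_wpM2l => //; have := A0 i j.
Qed.

Lemma expmxS_mul A k c : A ^+ k.+1 *m c = A *m (A ^+ k *m c).
Proof. by rewrite exprS mulmxA. Qed.

Lemma expmxSr_mul A k c : A ^+ k.+1 *m c = A ^+ k *m (A *m c).
Proof. by rewrite exprSr mulmxA. Qed.

Lemma expmx_mul_le A k c d : A \is a mxOver Num.nneg -> le_cv c d ->
  le_cv (A ^+ k *m c) (A ^+ k *m d).
Proof.
move=> A0 cd; elim: k => [|k IH]; first by rewrite !mul1mx.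
by rewrite !expmxS_mul; exact: mulmx_le.
Qed.

Lemma stable_mx_exp_mul A c i :
  stable_mx A -> (fun k => (A^T ^+ k *m c) i 0) @ \oo --> 0.
Proof.
move=> stA; under eq_fun => k do rewrite mxE.
suff : (fun k => \sum_j (A^T ^+ k) i j * c j 0) @ \oo --> \sum_(j < n) (0 * c j 0).
  by rewrite [in X in _ -> X]/= big1 // => j _; rewrite mul0r.
apply: cvg_big => [|j _]; first exact: add_continuous.
apply: cvgMl; have := stable_mx_exp stA j i; apply: cvg_trans.
apply: near_eq_cvg; apply: nearW => k.
suff -> : A^T ^+ k = (A ^+ k)^T by rewrite mxE.
elim: k => [|k IH]; first by rewrite !expr0 trmx1.
by rewrite exprS exprSr -!mulmxE trmx_mul IH.
Qed.

(** A nonzero vector killed by [1 - A] would make 1 an eigenvalue, and 1 is not strictly inside the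
    unit circle. *)
Lemma stable_mx_unit A : stable_mx A -> 1%:M - A \in unitmx.
Proof.
move=> stA; rewrite unitmxE unitfE; apply/negP => /det0P[v v0].
rewrite mulmxBr mulmx1 => /subr0_eq vA.
have : eigenvalue A 1 by apply/eigenvalueP; exists v; rewrite // scale1r.
rewrite -(eigenvalue_map (real_complex R)) => /stA.
by rewrite rmorph1 normr1 ltxx.
Qed.

Lemma le_cv_scale c d : (forall i, 0 < d i 0) -> exists a, le_cv c (a *: d).
Proof.
(* The sum of the ratios bounds each one of them, and also makes sense in dimension 0. *)
move=> d0; exists (\sum_i `|c i 0| / d i 0) => i; rewrite mxE -ler_pdivrMr //.
rewrite (bigD1 i) //= ler_wpDr ?sumr_ge0 // => [j _|]; first by rewrite divr_ge0 // ltW.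
by rewrite ler_pM2r ?invr_gt0 // ler_norm.
Qed.

End DotProduct.

(** * Monotonicity and continuity of [G] *)

Section ValueIteration.
Context {R : realType} {n : nat} {U : Type}.
Variable P : problem R n U.
Hypothesis hP : is_semilinear P.
Hypothesis hCA : closure_attainability P.
Hypothesis hX : state_space_structure P.
Implicit Types (c d x : 'cV[R]_n) (mu : 'cV[R]_n -> U) (A : 'M[R]_n).

Local Notation alpha := (discount P).

(** Every coordinate axis is reached by scaling a state, so comparing linear forms on the states
    compares their coefficients. *)
Lemma delta_states i :
  exists x s, [/\ states P x, 0 <= s & s *: x = delta_mx i 0].
Proof.
by apply: hX; apply/nneg_orthantP => j; rewrite !mxE; case: (_ && _).
Qed.

Lemma le_cv_states c d :
  (forall x, states P x -> dotv c x <= dotv d x) -> le_cv c d.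
Proof.
move=> cd i; have [x [s [Xx s0 sx]]] := delta_states i.
by rewrite -(dotv_delta c) -(dotv_delta d) -sx !dotvZr ler_wpM2l ?cd.
Qed.

Lemma eq_cv_states c d :
  (forall x, states P x -> dotv c x = dotv d x) -> c = d.
Proof. by move=> cd; apply: le_cv_anti; apply: le_cv_states => x /cd ->. Qed.

Lemma states_ge0 x : states P x -> le_cv 0 x.
Proof. by move=> Xx; apply/nneg_orthantP; exact: (states_nneg hP). Qed.

Lemma G_spec c : le_cv 0 c -> bellman_vector P c (G P c).
Proof.
move=> /nneg_orthantP c0; have [+ _ _] := hCA => /(_ c c0) [d [cd _]].
by apply: xgetPex; exists d.
Qed.

Lemma G_ge0 c : le_cv 0 c -> le_cv 0 (G P c).
Proof. by move=> /G_spec[/nneg_orthantP]. Qed.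

Lemma G_le_bellman c x v : le_cv 0 c -> states P x -> controls P x v ->
  dotv (G P c) x <= bellman_rhs P c x v.
Proof. by move=> /G_spec[_ +] Xx xv => /(_ x Xx)[_]; apply; exists v. Qed.

(** A control attaining the minimum for [d] is a candidate for [c], and the next state is
    nonnegative. *)
Lemma G_mono c d : le_cv 0 c -> le_cv c d -> le_cv (G P c) (G P d).
Proof.
move=> c0 cd; apply: le_cv_states => x Xx.
have [_ /(_ x Xx)[[v xv <-] _]] := G_spec (le_cv_trans c0 cd).
apply: le_trans (G_le_bellman c0 Xx xv) _; rewrite /bellman_rhs lerD2l.
rewrite ler_pM2l ?(discount_gt0 hP) //; apply: dotv_le cd.
by apply: states_ge0; exact: (dyn_states hP).
Qed.

Lemma iter_G_ge0 k c : le_cv 0 c -> le_cv 0 (iter k (G P) c).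
Proof. by move=> c0; elim: k => //= k; exact: G_ge0. Qed.

Lemma iter_G_mono k c d : le_cv 0 c -> le_cv c d ->
  le_cv (iter k (G P) c) (iter k (G P) d).
Proof.
move=> c0 cd; elim: k => //= k IH.
by apply: G_mono => //; exact: iter_G_ge0.
Qed.

Lemma iter_G0_nondecreasing i :
  {homo (fun k => iter k (G P) 0 i 0) : k m / (k <= m)%N >-> k <= m}.
Proof.
apply/nondecreasing_seqP => k; rewrite iterSr.
by apply: iter_G_mono => //; exact: G_ge0.
Qed.

(** Continuity of [G] is relative to the orthant, so the sequence and its limit must both lie
    there. *)
Lemma cvg_G (u : nat -> 'cV[R]_n) c : (forall k, le_cv 0 (u k)) -> le_cv 0 c ->
  u @ \oo --> c -> (fun k => G P (u k)) @ \oo --> G P c.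
Proof.
move=> u0 c0 uc; have [_ + _] := hCA.
move=> /subspace_continuousP/(_ c); move/nneg_orthantP: (c0) => /[swap]/[apply].
apply: cvg_trans => S; rewrite /= !nbhs_filterE /within /= => cS.
apply: (@filterS nat \oo _ _ _ _ (uc _ cS)) => k; apply.
by apply/nneg_orthantP.
Qed.

(** * The affine map and the closed loop of a linear policy *)

Section Policy.
Variables (mu : 'cV[R]_n -> U) (A : 'M[R]_n) (q : 'cV[R]_n).
Hypothesis Mmu : policies P mu.
Hypothesis muA : linear_dyn P mu A.
Hypothesis muq : linear_cost P mu q.

Local Notation B := (alpha *: A^T).

Lemma policy_mx_ge0 : B \is a mxOver Num.nneg.
Proof.
apply/mxOverP => i j; rewrite !mxE nnegrE mulr_ge0 ?(ltW (discount_gt0 hP)) //.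
by have [/mxOverP/(_ j i)] := muA.
Qed.

(** Moving the dynamics [A] from the state onto the cost vector is what transposes it in [B]. *)
Lemma bellman_policy c x : states P x ->
  bellman_rhs P c x (mu x) = dotv (q + B *m c) x.
Proof.
move=> Xx; rewrite /bellman_rhs muq // muA.2 // dotvDl -scalemxAl dotvZl.
by rewrite dotv_mulmx.
Qed.

Lemma policy_cost_ge0 : le_cv 0 q.
Proof.
apply: le_cv_states => x Xx; rewrite dotv0l -muq // (cost_ge0 hP) //.
exact: (policies_admissible hP).
Qed.

Lemma G_le_policy c : le_cv 0 c -> le_cv (G P c) (q + B *m c).
Proof.
move=> c0; apply: le_cv_states => x Xx; rewrite -bellman_policy //.
by apply: G_le_bellman => //; exact: (policies_admissible hP).
Qed.

Lemma G_eq_policy c : le_cv 0 c ->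
  (forall x, states P x -> argmin_bellman P c x (mu x)) -> G P c = q + B *m c.
Proof.
move=> c0 cmu; apply: eq_cv_states => x Xx; rewrite -bellman_policy //.
apply/le_anti/andP; split.
  by apply: G_le_bellman => //; exact: (policies_admissible hP).
have [_ /(_ x Xx)[[v xv <-] _]] := G_spec c0.
exact: (cmu x Xx).2.
Qed.

(* The map [c |-> q + B c] dominates [G], and acts as [B] on differences with
   its fixed point [d]. *)
Lemma iter_G_le_policy k c d : le_cv 0 c -> d = q + B *m d ->
  le_cv (iter k (G P) c) (d + B ^+ k *m (c - d)).
Proof.
move=> c0 dE; elim: k => [|k IH]; first by rewrite mul1mx addrC subrK.
apply: le_cv_trans (G_le_policy (iter_G_ge0 k c0)) _.
move=> i; have := mulmx_le policy_mx_ge0 IH i.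
rewrite mulmxDr -expmxS_mul => h.
have dEi : d i 0 = q i 0 + (B *m d) i 0 by rewrite [in LHS]dE mxE.
by rewrite !mxE in h dEi *; rewrite dEi -addrA lerD2l.
Qed.

Definition closed_loop x k := iter k (fun y => dyn P y (mu y)) x.

(** The open-loop control sequence produced by [mu] from [x]; costs are defined on such
    sequences. *)
Definition feedback x k := mu (closed_loop x k).

Lemma trajectory_feedback x k :
  trajectory P x (feedback x) k = closed_loop x k.
Proof. by elim: k => //= k ->. Qed.

Lemma closed_loop_states x k : states P x -> states P (closed_loop x k).
Proof.
move=> Xx; elim: k => //= k IH; apply: (dyn_states hP) => //.
exact: (policies_admissible hP).
Qed.

Lemma feedback_admissible x : states P x -> admissible P x (feedback x).
Proof.
move=> Xx k; rewrite trajectory_feedback.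
exact/(policies_admissible hP Mmu)/closed_loop_states.
Qed.

(** The factor [B] next to [c] is traded for one discounted step from the last state, hence an
    induction over all [c]. *)
Lemma dotv_expmx_closed_loop x k c : states P x ->
  dotv (B ^+ k *m c) x = alpha ^+ k * dotv c (closed_loop x k).
Proof.
move=> Xx; elim: k c => [|k IH] c; first by rewrite mul1mx expr0 mul1r.
rewrite expmxSr_mul IH -scalemxAl dotvZl dotv_mulmx -muA.2 ?mulrA -?exprSr //.
exact: closed_loop_states.
Qed.

(** The sum telescopes: since [q = c - B c], stage [k] contributes [B^k c - B^(k+1) c]. *)
Lemma sum_stage_cost_feedback x k c : states P x -> c = q + B *m c ->
  \sum_(0 <= j < k) stage_cost P x (feedback x) j = dotv (c - B ^+ k *m c) x.
Proof.
move=> Xx cE; elim: k => [|k IH].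
  by rewrite big_geq // mul1mx subrr dotv0l.
rewrite big_nat_recr //= IH /stage_cost trajectory_feedback muq; last first.
  exact: closed_loop_states.
rewrite -dotv_expmx_closed_loop // -dotvDl; congr dotv.
have Bc : B *m c = c - q by rewrite [in RHS]cE [q + _]addrC addrK.
by rewrite expmxSr_mul Bc mulmxBr opprB -addrA (addrC (- _)).
Qed.

(** Each partial sum of the feedback cost is [c'x] minus the nonnegative remainder [(B^k c)'x]. *)
Lemma optimal_cost_le_policy c x : le_cv 0 c -> c = q + B *m c -> states P x ->
  (optimal_cost P x <= (dotv c x)%:E)%E.
Proof.
move=> c0 cE Xx; apply: le_trans.
  apply: ereal_inf_lbound; exists (feedback x); last reflexivity.
  exact: feedback_admissible.
apply: lime_le.
  apply: is_cvg_nneseries => k _ _; rewrite lee_fin mulr_ge0 //.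
    by rewrite exprn_ge0 // ltW // (discount_gt0 hP).
  apply: (cost_ge0 hP); last exact: feedback_admissible.
  by rewrite trajectory_feedback; exact: closed_loop_states.
apply: nearW => k; rewrite sumEFin lee_fin (sum_stage_cost_feedback k Xx cE).
rewrite dotvBl gerBl dotv_expmx_closed_loop // mulr_ge0 //.
  by rewrite exprn_ge0 // ltW // (discount_gt0 hP).
rewrite -(dotv0l (closed_loop x k)); apply: dotv_le c0.
exact/states_ge0/closed_loop_states.
Qed.

Lemma optimal_cost_upto_le_policy c x N : c = q + B *m c -> states P x ->
  (optimal_cost_upto P N x <= (dotv (c - B ^+ N *m c) x)%:E)%E.
Proof.
move=> cE Xx; apply: ereal_inf_lbound; exists (feedback x).
  by move=> k _; exact: feedback_admissible.
by rewrite (sum_stage_cost_feedback N Xx cE).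
Qed.

(* By observability [B^N c] lies strictly below [c] in every coordinate; [B^k c]
   decreases to a limit, so the powers of [B] kill the positive vector
   [c - B^N c], and hence every nonnegative vector. *)
Lemma observable_policy_exp_cvg0 c d i : observability P ->
  le_cv 0 c -> c = q + B *m c -> le_cv 0 d ->
  (fun k => (B ^+ k *m d) i 0) @ \oo --> 0.
Proof.
move=> [N hN] c0 cE d0; pose w := c - B ^+ N *m c.
have w0 j : 0 < w j 0.
  have [x [s [Xx s0 sx]]] := delta_states j.
  (* Observability concerns nonzero states; [s] and [x] are nonzero because their product is a basis
     vector. *)
  have sx0 : s *: x != 0.
    rewrite sx; apply/negP => /eqP/matrixP/(_ j 0)/eqP.
    by rewrite !mxE !eqxx oner_eq0.
  move: sx0; rewrite scaler_eq0 negb_or => /andP[s_neq0 x_neq0].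
  rewrite -(dotv_delta w) -sx dotvZr.
  apply: mulr_gt0; first by rewrite lt0r s_neq0.
  rewrite -lte_fin.
  exact: lt_le_trans (hN x Xx x_neq0) (optimal_cost_upto_le_policy N cE Xx).
have Bw : (fun k => (B ^+ k *m w) i 0) @ \oo --> 0.
  pose v k := (B ^+ k *m c) i 0.
  have v_noninc : {homo v : k m / (k <= m)%N >-> m <= k}.
    apply/nonincreasing_seqP => k; rewrite /v expmxSr_mul.
    apply: expmx_mul_le policy_mx_ge0 _ _ => j.
    by rewrite [in leRHS]cE !mxE lerDr; have := policy_cost_ge0 j; rewrite mxE.
  have v_cvg : cvgn v.
    apply: nonincreasing_is_cvgn => //; exists 0 => _ [k _ <-].
    by have := expmx_mul_le k policy_mx_ge0 c0 i; rewrite mulmx0 mxE.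
  rewrite -(subrr (limn v)).
  (* Both terms of this difference have the limit of [v]. *)
  have -> : (fun k => (B ^+ k *m w) i 0) = (fun k => v k - v (k + N)%N).
    apply/funext => k; rewrite /v /w mulmxBr mulmxA mulmxE -exprD [LHS]mxE.
    by congr (_ + _); rewrite mxE.
  by apply: cvgB; rewrite ?(cvg_shiftn N).
have [a da] := le_cv_scale d w0.
have : (fun k => a * (B ^+ k *m w) i 0) @ \oo --> 0.
  by rewrite -(mulr0 a); exact: cvgMr.
apply: squeeze_cvgr (cvg_cst 0); apply: nearW => k.
have := expmx_mul_le k policy_mx_ge0 d0 i.
have := expmx_mul_le k policy_mx_ge0 da i.
by rewrite mulmx0 -scalemxAr !mxE => -> ->.
Qed.

End Policy.

(** * Value iteration from zero and the optimal cost *)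

(** The outermost [G] accounts for the first stage; the induction hypothesis covers the shifted
    controls from the next state. *)
Lemma iter_G0_le_sum m x u : states P x -> admissible P x u ->
  dotv (iter m (G P) 0) x <= \sum_(0 <= k < m) stage_cost P x u k.
Proof.
elim: m x u => [|m IH] x u Xx adm; first by rewrite big_geq // dotv0l.
have Xf : states P (dyn P x (u 0%N)).
  by apply: (dyn_states hP) => //; exact: (adm 0%N).
have trajS k : trajectory P x u k.+1 =
    trajectory P (dyn P x (u 0%N)) (fun j => u j.+1) k.
  by elim: k => //= k <-.
have admS : admissible P (dyn P x (u 0%N)) (fun j => u j.+1).
  by move=> k; rewrite -trajS; exact: adm.
rewrite big_nat_recl // iterS.
apply: le_trans (G_le_bellman (iter_G_ge0 m _) Xx (adm 0%N)) _ => //.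
rewrite /bellman_rhs {1}/stage_cost /= expr0 mul1r lerD2l.
have := IH _ _ Xf admS; rewrite -(ler_pM2l (discount_gt0 hP)).
move=> /le_trans; apply.
rewrite mulr_sumr; apply: ler_sum => k _.
by rewrite /stage_cost trajS exprS mulrA.
Qed.

Lemma iter_G0_cvg : stabilizability P ->
  exists2 c, le_cv 0 c & (fun k => iter k (G P) 0) @ \oo --> c.
Proof.
move=> [mu [A [Mmu muA stA]]].
have [_ [q [_ muq]]] : exists (A : 'M[R]_n) q, linear_dyn P mu A /\ linear_cost P mu q.
  exact: (policies_linear hP).
pose B := alpha *: A^T.
have B1 : 1%:M - B \in unitmx.
  rewrite -unitmx_tr linearB /= trmx1 /B linearZ /= trmxK.
  exact: stable_mx_unit.
(* The cost vector of the stabilizing policy, solving [d = q + B d]. *)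
pose d := invmx (1%:M - B) *m q.
have dE : d = q + B *m d.
  by apply/eqP; rewrite -subr_eq -{1}[d]mul1mx -mulmxBl /d mulKVmx.
(* Monotonicity bounds the [k]-th iterate by every later one, which is at most [d + B^m (0 - d)].
   The correction vanishes as [m] grows, so no sign of [d] is involved. *)
have u_ub i k : iter k (G P) 0 i 0 <= d i 0.
  have : (fun m => d i 0 + (B ^+ m *m (0 - d)) i 0) @ \oo --> d i 0 + 0.
    apply: cvgD; first exact: cvg_cst.
    have -> : B = (alpha *: A)^T by rewrite [RHS]linearZ.
    exact: stable_mx_exp_mul.
  rewrite addr0 => hlim; rewrite -(cvg_lim (@Rhausdorff R) hlim).
  apply: limr_ge; first exact: cvgP hlim.
  near=> m; apply: le_trans (iter_G0_nondecreasing i (_ : (k <= m)%N)) _.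
    by near: m; exact: nbhs_infty_ge.
  have := iter_G_le_policy Mmu muA muq m (fun=> lexx _) dE i.
  by rewrite mxE.
have u_cvg i : cvgn (fun k => iter k (G P) 0 i 0).
  apply: nondecreasing_is_cvgn; first exact: iter_G0_nondecreasing.
  by exists (d i 0) => _ [k _ <-].
exists (\col_i limn (fun k => iter k (G P) 0 i 0)).
  move=> i; rewrite !mxE; apply: limr_ge => //; apply: nearW => k.
  by have := iter_G_ge0 k (fun=> lexx _) i; rewrite mxE.
by apply: cvg_mx_entry => i j; rewrite ord1 mxE.
Unshelve. all: by end_near. Qed.

(** The shifted sequence of iterates tends to [c], and by continuity to [G P c]. *)
Lemma iter_G0_cvg_fixed c : le_cv 0 c ->
  (fun k => iter k (G P) 0) @ \oo --> c -> G P c = c.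
Proof.
move=> c0 uc; have u0 k : le_cv 0 (iter k (G P) 0) by exact: iter_G_ge0.
have Guc := cvg_G u0 c0 uc; apply/colP => i.
have := @cvg_entry_mx _ _ _ _ _ i 0 Guc; move/cvg_lim => <- //.
have := @cvg_entry_mx _ _ _ _ _ i 0 uc; rewrite -cvg_shiftS; exact: cvg_lim.
Qed.

(** With nonnegative stage costs, the total cost of any admissible sequence dominates its partial
    sums, hence every [G^k(0)'x], and then their limit. *)
Lemma optimal_cost_ge_iter_G0 c x :
  (fun k => iter k (G P) 0) @ \oo --> c -> states P x ->
  ((dotv c x)%:E <= optimal_cost P x)%E.
Proof.
move=> uc Xx; apply: le_ereal_inf_tmp => _ [u adm <-].
have Xu k : states P (trajectory P x u k).
  by elim: k => //= k IH; exact: (dyn_states hP).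
have u_cvg : (fun k => dotv (iter k (G P) 0) x) @ \oo --> dotv c x.
  under eq_fun do rewrite dotvE; rewrite dotvE.
  apply: cvg_big => [|i _]; first exact: add_continuous.
  by apply: cvgMl; exact: cvg_entry_mx.
have eu_cvg : (fun k => (dotv (iter k (G P) 0) x)%:E) @ \oo --> (dotv c x)%:E.
  by apply: cvg_EFin => //; exact: nearW.
rewrite -(cvg_lim _ eu_cvg) //; apply: lime_le; first exact: cvgP eu_cvg.
apply: nearW => k; apply: le_trans (nneseries_lim_ge k _).
  by rewrite sumEFin lee_fin; exact: iter_G0_le_sum.
move=> j _ _; rewrite lee_fin mulr_ge0 ?(cost_ge0 hP) //.
by rewrite exprn_ge0 // ltW // (discount_gt0 hP).
Qed.

End ValueIteration.

Theorem proposition3 (R : realType) (n : nat) (U : Type) (P : problem R n U)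
    (hP : is_semilinear P)
    (hCA : closure_attainability P)
    (hS : stabilizability P)
    (hX : state_space_structure P)
    (hO : observability P)
    (c0 : 'cV[R]_n) (hc0 : nneg_orthant c0) :
  (fun k : nat => iter k (G P) c0) @ \oo --> optimal_cost_vector P.
Proof.
have [c c_ge0 uc] := iter_G0_cvg hP hCA hX hS.
have Gc := iter_G0_cvg_fixed hCA c_ge0 uc.
have [_ _ /(_ c)] := hCA; case=> [|mu [Mmu cmu]]; first exact/nneg_orthantP.
have [A [q [muA muq]]] := policies_linear hP Mmu.
have cE : c = q + (discount P *: A^T) *m c.
  by rewrite -(G_eq_policy hP hCA hX Mmu muA muq c_ge0 cmu).
have c_opt : is_optimal_cost_vector P c.
  split=> [|x Xx]; first exact/nneg_orthantP.
  apply/le_anti/andP; split.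
    exact: (optimal_cost_le_policy hP Mmu muA muq).
  exact: (optimal_cost_ge_iter_G0 hP hCA).
(* As [c] is an optimal cost vector, [xget] does not return its default; two such vectors agree on
   the states, hence coincide. *)
have -> : optimal_cost_vector P = c.
  apply: xget_unique => // d [_ d_opt].
  apply: (eq_cv_states hX) => x Xx; apply: EFin_inj.
  by rewrite -d_opt // (c_opt.2 x Xx).
have {}hc0 : le_cv 0 c0 by apply/nneg_orthantP.
apply: cvg_mx_entry => i j; rewrite ord1.
have lo := @cvg_entry_mx _ _ _ _ _ i 0 uc.
(* The term [- B^k c] of the upper bound [c + B^k (c0 - c)] is nonpositive and gets dropped:
   [c0 - c] may have negative entries, while the decay of [B^k] is known on nonnegative vectors such
   as [c0]. *)
have hi : (fun k => c i 0 + ((discount P *: A^T) ^+ k *m c0) i 0) @ \oo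
    --> c i 0 + 0.
  apply: cvgD; first exact: cvg_cst.
  exact: (observable_policy_exp_cvg0 hP hX Mmu muA muq i hO c_ge0 cE hc0).
rewrite addr0 in hi; apply: squeeze_cvgr lo hi; apply: nearW => k; apply/andP; split.
  exact: (iter_G_mono hP hCA hX k (fun=> lexx _) hc0).
apply: le_trans (iter_G_le_policy hP hCA hX Mmu muA muq k hc0 cE i) _.
rewrite mulmxBr !mxE lerD2l gerBl.
have := expmx_mul_le k (policy_mx_ge0 hP muA) c_ge0 i.
by rewrite mulmx0 !mxE.
Qed.
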